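(* Let $(D,\sigma)$ be a signed digraph with signed double cover $\widetilde D_\sigma$ and deck involution $\tau$. For every $p\ge 0$, \[ H_p^\sigma(D)\;\cong\; H_p(\widetilde D_\sigma)^-=\{\alpha\in H_p(\widetilde D_\sigma):\tau\alpha=-\alpha\}. \] The isomorphism is induced by the chain isomorphism \[ \Lambda_\bullet:\Omega_\bullet^\sigma(D)\longrightarrow \Omega_\bullet(\widetilde D_\sigma)^-, \] the restriction of the maps $[e_{\widetilde\delta}]\mapsto e_{\widetilde\delta}-e_{\tau\widetilde\delta}$.
   Context: Signed digraphs. A signed digraph is a pair $(D,\sigma)$ where $D=(V,A)$ is a finite loopless digraph with at most one arrow from $i$ to $j$ for each ordered pair $(i,j)$, and $\sigma:A\to\{+1,-1\}$ is any function (antiparallel arrows $i\to j$, $j\to i$ are allowed and may have different signs). Write $\sigma(ij)$ for the sign of $i\to j$. Ordinary GLMY homology (real coefficients). For a finite loopless digraph $X$, an elementary $p$-path is a sequence $i_0\cdots i_p$ of vertices; it is regular if consecutive vertices are distinct, and allowed if $i_{r-1}\to i_r$ is an arrow for $1\le r\le p$. $\mathcal R_p(X)$ is the real vector space with basis $e_\gamma$, $\gamma$ a regular $p$-path (no arrow condition); $\mathcal A_p(X)\subseteq\mathcal R_p(X)$ is the span of the $e_\gamma$ with $\gamma$ allowed. For $p\ge1$, $\partial_p e_{i_0\cdots i_p}=\sum_{q=0}^p(-1)^q e_{i_0\cdots\widehat{i_q}\cdots i_p}$, nonregular terms being zero; $\partial_0=0$, $\mathcal R_{-1}=0$. Set $\Omega_0(X)=\mathcal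 A_0(X)$, $\Omega_p(X)=\{u\in\mathcal A_p(X):\partial_pu\in\mathcal A_{p-1}(X)\}$ for $p\ge1$, $\Omega_{-1}=0$. These form a chain complex with boundary $\partial_*$, and $H_p(X)$ is its homology. Signed double cover. $\widetilde D_\sigma$ is the digraph with vertices $i^\varepsilon=(i,\varepsilon)\in V\times\{+1,-1\}$ and arrows $i^\varepsilon\to j^{\varepsilon\sigma(ij)}$ for each arrow $i\to j$ of $D$ and $\varepsilon\in\{+1,-1\}$. The deck involution is $\tau(i^\varepsilon)=i^{-\varepsilon}$; it acts on paths vertexwise, hence linearly on $\mathcal R_p(\widetilde D_\sigma)$, $\mathcal A_p(\widetilde D_\sigma)$, $\Omega_p(\widetilde D_\sigma)$ and $H_p(\widetilde D_\sigma)$. For a real vector space $C$ with involution $\tau$, $C^-:=\{x\in C:\tau x=-x\}$. Signed GLMY homology. $R_p^\sigma(D)$ is the quotient of $\mathcal R_p(\widetilde D_\sigma)$ by the span of all $e_{\tau\widetilde\gamma}+e_{\widetilde\gamma}$, $\widetilde\gamma$ a regular $p$-path on $V\times\{+1,-1\}$ (so $u^+u^-$ is regular, $u^+u^+$ is not); $[e_{\widetilde\gamma}]$ is the class of $e_{\widetilde\gamma}$. The boundary of $\mathcal R_\bullet(\widetilde D_\sigma)$ commutes with $\tau$ and induces $\partial^\sigma_{\mathrm{reg},p}:R_p^\sigma(D)\to R_{p-1}^\sigma(D)$ ($\partial^\sigma_{\mathrm{reg},0}=0$, $R^\sigma_{-1}=0$). $\mathcal A_p^\sigma(D)\subseteq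 R_p^\sigma(D)$ is the span of the classes of allowed paths of $\widetilde D_\sigma$. Set $\Omega_0^\sigma(D)=\mathcal A_0^\sigma(D)$, $\Omega_p^\sigma(D)=\{z\in\mathcal A_p^\sigma(D):\partial^\sigma_{\mathrm{reg},p}z\in\mathcal A^\sigma_{p-1}(D)\}$ for $p\ge1$, $\Omega^\sigma_{-1}=0$, and let $\partial_p^\sigma$ be the restriction of $\partial^\sigma_{\mathrm{reg},p}$ to $\Omega_p^\sigma(D)\to\Omega_{p-1}^\sigma(D)$. $H_p^\sigma(D)$ is the homology of $(\Omega_\bullet^\sigma(D),\partial_*^\sigma)$. The map $\Lambda_p:R_p^\sigma(D)\to\mathcal R_p(\widetilde D_\sigma)^-$ is the linear map $[e_{\widetilde\delta}]\mapsto e_{\widetilde\delta}-e_{\tau\widetilde\delta}$. *)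

(* Defs.v *)
From HB Require Import structures.
From mathcomp Require Import all_boot all_order all_algebra.
From mathcomp Require Import reals.

Set Implicit Arguments.
Unset Strict Implicit.
Unset Printing Implicit Defensive.

Import GRing.Theory.
Local Open Scope ring_scope.
Local Open Scope quotient_scope.

Section QuotientSpace.
Variables (K : fieldType) (vT : vectType K).

Definition quotv (U : {vspace vT}) : Type := Quotient.quot U.

HB.instance Definition _ (U : {vspace vT}) := ZmodQuotient.on (quotv U).

Variable U : {vspace vT}.
Local Notation Q := (quotv U).

Lemma quotv_eqP (x y : vT) : reflect (\pi_Q x = \pi_Q y) (x - y \in U).
Proof.
have := @eqP _ (\pi_(Quotient.quot U) x) (\pi_(Quotient.quot U) y).
by rewrite -(Quotient.idealrBE U).
Qed.

Lemma quotv_piD : {morph \pi_Q : x y / x + y}.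
Proof. exact: (raddfD (\pi_(Quotient.quot U))). Qed.

Definition quotv_scale (a : K) (x : Q) : Q := \pi_Q (a *: repr x).

Lemma quotv_piZ a x : \pi_Q (a *: x) = quotv_scale a (\pi_Q x).
Proof.
apply/quotv_eqP; rewrite -scalerBr; apply: memvZ.
by apply/quotv_eqP; rewrite reprK.
Qed.

Fact quotv_scaleA a b x : quotv_scale a (quotv_scale b x) = quotv_scale (a * b) x.
Proof. by elim/quotW: x => x; rewrite -!(quotv_piZ _ x) -quotv_piZ scalerA. Qed.

Fact quotv_scale1 : left_id 1 quotv_scale.
Proof. by elim/quotW => x; rewrite -quotv_piZ scale1r. Qed.

Fact quotv_scaleDr : right_distributive quotv_scale +%R.
Proof.
move=> a; elim/quotW => x; elim/quotW => y.
by rewrite -quotv_piD -!(quotv_piZ a) scalerDr quotv_piD.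
Qed.

Fact quotv_scaleDl x : {morph quotv_scale^~ x : a b / a + b}.
Proof.
move=> a b; elim/quotW: x => x /=.
by rewrite -!(quotv_piZ _ x) scalerDl quotv_piD.
Qed.

HB.instance Definition _ := GRing.Zmodule_isLmodule.Build K (quotv U)
  quotv_scaleA quotv_scale1 quotv_scaleDr quotv_scaleDl.

Fact quotv_pi_linear : linear (\pi_Q : vT -> Q).
Proof. by move=> a x y; rewrite quotv_piD quotv_piZ. Qed.

HB.instance Definition _ :=
  GRing.isLinear.Build K vT Q _ (\pi_Q : vT -> Q) quotv_pi_linear.

Import VectorInternalTheory.
Fact quotv_vect_iso : Vector.axiom (dim (subvs_of U^C)) Q.
Proof.
pose h v := vsproj U^C (v - projv U v).
pose f (x : Q) := v2r (h (repr x)).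
have h_is_linear : linear h.
  by move=> a x y; rewrite /h linearP opprD addrACA -scalerBr linearP.
have fE v : f (\pi_Q v) = v2r (h v).
  have /quotv_eqP : \pi_Q (repr (\pi_Q v)) = \pi_Q v by rewrite reprK.
  move=> Uv; rewrite /f; congr v2r; rewrite -[X in h X](subrK v).
  rewrite -[repr _ - v]scale1r h_is_linear.
  by rewrite [h (_ - _)]/h projv_id // subrr linear0 scaler0 add0r.
exists f.
  move=> a x y; rewrite -[x]reprK -[y]reprK -quotv_pi_linear !fE.
  by rewrite h_is_linear linearP.
exists (fun r => \pi_Q (vsval (r2v r))) => [x | r].
  rewrite /f v2rK -[RHS]reprK vsprojK ?memv_projC //.
  by apply/quotv_eqP; rewrite addrC addKr rpredN memv_proj.
rewrite fE -[RHS]r2vK; congr v2r; rewrite /h.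
set w := r2v r; have : vsval w \in lker (projv U) by rewrite lker_proj subvsP.
by rewrite memv_ker => /eqP ->; rewrite subr0 vsvalK.
Qed.

HB.instance Definition _ :=
  Lmodule_hasFinDim.Build K (quotv U) quotv_vect_iso.

Definition qpi : 'Hom(vT, quotv U) := linfun (\pi_Q : vT -> Q).

Lemma qpiE x : qpi x = \pi_Q x. Proof. exact: lfunE. Qed.

Lemma qpi_eqP x y : reflect (qpi x = qpi y) (x - y \in U).
Proof. by rewrite !qpiE; apply: quotv_eqP. Qed.

(* [qlift f] is meaningful only when f vanishes on U; see qlift_qpi. *)
Definition qlift (wT : vectType K) (f : 'Hom(vT, wT)) : 'Hom(quotv U, wT) :=
  linfun (fun x : quotv U => f (repr x)).

Lemma qlift_qpi (wT : vectType K) (f : 'Hom(vT, wT)) x :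
  (U <= lker f)%VS -> qlift f (qpi x) = f x.
Proof.
move=> Uf; pose g (x : quotv U) := f (repr x).
have gE v : g (\pi_Q v) = f v.
  apply/eqP; rewrite -subr_eq0 -linearB -memv_ker; apply: subvP Uf _ _.
  by apply/quotv_eqP; rewrite reprK.
have g_lin : linear g.
  by move=> a y z; rewrite -[y]reprK -[z]reprK -quotv_pi_linear !gE linearP.
pose gL := GRing.isLinear.Build K (quotv U) wT _ g g_lin.
pose G : {linear quotv U -> wT} := HB.pack g gL.
by rewrite /qlift (lfunE G) qpiE; apply: gE.
Qed.

End QuotientSpace.

Section Minus.
Variables (K : fieldType) (C : vectType K) (t : 'End(C)).

Definition minus_part : {vspace C} := lker (t + \1%VF).

Lemma minus_partP x : reflect (t x = - x) (x \in minus_part).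
Proof. by rewrite memv_ker add_lfunE id_lfunE addr_eq0; apply: eqP. Qed.

End Minus.

(* Here d p is the boundary C_{p+1} -> C_p, and the boundary of C_0 is 0. *)
Section SpanComplex.
Variables (K : fieldType) (C : nat -> vectType K).
Variables (d : forall p, 'Hom(C p.+1, C p)) (A : forall p, {vspace C p}).

Definition Omega p : {vspace C p} :=
  match p with
  | 0 => A 0
  | q.+1 => A q.+1 :&: (d q @^-1: A q)
  end.

Definition cycles p : {vspace C p} :=
  match p with
  | 0 => Omega 0
  | q.+1 => Omega q.+1 :&: lker (d q)
  end.

Definition boundaries p : {vspace C p} := (d p @: Omega p.+1)%VS.

(* cycles modulo boundaries, as a quotient of the space subvs_of (cycles p);
   the boundaries are pulled back along the inclusion vsval *)
Definition homology p : vectType K :=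
  quotv (linfun (vsval : subvs_of (cycles p) -> C p) @^-1: boundaries p).

(* The homology class of a cycle; meaningful only on cycles. *)
Definition hclass p : 'Hom(C p, homology p) :=
  (qpi _ \o linfun (vsproj (cycles p)))%VF.

Lemma hclass_eqP p z z' : z \in cycles p -> z' \in cycles p ->
  reflect (hclass p z = hclass p z') (z - z' \in boundaries p).
Proof.
move=> Zz Zz'; have := @qpi_eqP _ _ (linfun
  (vsval : subvs_of (cycles p) -> C p) @^-1: boundaries p)%VS
  (vsproj (cycles p) z) (vsproj (cycles p) z').
rewrite -memv_preim linearB /= ![linfun vsval _]lfunE /= !vsprojK //.
by rewrite /hclass !comp_lfunE ![linfun _ _]lfunE.
Qed.

End SpanComplex.

Section InducedMap.
Variables (K : fieldType) (C C' : nat -> vectType K).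
Variables (d : forall p, 'Hom(C p.+1, C p)) (A : forall p, {vspace C p}).
Variables (d' : forall p, 'Hom(C' p.+1, C' p)) (A' : forall p, {vspace C' p}).
Variable f : forall p, 'Hom(C p, C' p).

(* Meaningful only when f is a chain map compatible with A and A'; see
   hmap_hclass. *)
Definition hmap p : 'Hom(homology d A p, homology d' A' p) :=
  qlift _ (hclass d' A' p \o f p \o
           linfun (vsval : subvs_of (cycles d A p) -> C p))%VF.

Hypothesis fA : forall p u, u \in A p -> f p u \in A' p.
Hypothesis fd : forall p u, d' p (f p.+1 u) = f p (d p u).

Lemma Omega_map p u : u \in Omega d A p -> f p u \in Omega d' A' p.
Proof.
case: p u => [|p] u; first exact: fA.
by rewrite !memv_cap -!memv_preim fd => /andP[Au Adu]; rewrite !fA.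
Qed.

Lemma cycles_map p u : u \in cycles d A p -> f p u \in cycles d' A' p.
Proof.
case: p u => [|p] u; first exact: fA.
rewrite !memv_cap -!memv_preim !memv_ker fd => /andP[/andP[Au Adu] /eqP du0].
by rewrite !fA // du0 linear0 eqxx.
Qed.

Lemma hmap_hclass p z :
  z \in cycles d A p -> hmap p (hclass d A p z) = hclass d' A' p (f p z).
Proof.
move=> Zz; rewrite {1}/hclass comp_lfunE qlift_qpi; last first.
  apply/subvP => w; rewrite -memv_preim lfunE /= => Bw.
  rewrite memv_ker 2!comp_lfunE [linfun vsval _]lfunE /=.
  rewrite -(linear0 (hclass d' A' p)).
  apply/eqP/hclass_eqP; rewrite ?mem0v ?cycles_map ?subvsP // subr0.
  case/memv_imgP: Bw => b Ob ->; rewrite -fd; exact/memv_img/Omega_map.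
by rewrite 2!comp_lfunE !lfunE /= vsprojK.
Qed.

End InducedMap.

Record digraph := Digraph {
  vertex :> finType;
  arrow : rel vertex;
  arrow_irr : irreflexive arrow }.

(* The boolean [sgn i j] encodes the sign (-1) ^+ sgn i j of the arrow i -> j,
   and is irrelevant when there is no such arrow; signs multiply by (+). *)
Record signed_digraph := SignedDigraph {
  base :> digraph;
  sgn : base -> base -> bool }.

Section PathHomology.
Variables (K : fieldType) (X : digraph).

Definition regular p (t : p.+1.-tuple X) : bool :=
  sorted (fun x y : X => x != y) t.

Definition allowed p (t : p.+1.-tuple X) : bool := sorted (@arrow X) t.

Definition rpath p := {t : p.+1.-tuple X | regular t}.

Definition Rchain p : vectType K := {ffun rpath p -> K^o}.

(* e_t, with the convention that e_t = 0 when t is not regular *)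
Definition elem p (t : p.+1.-tuple X) : Rchain p :=
  [ffun g : rpath p => (val g == t)%:R].

Definition lext (vT : vectType K) p (f : p.+1.-tuple X -> vT) :
    'Hom(Rchain p, vT) :=
  linfun (fun u : Rchain p => \sum_(g : rpath p) u g *: f (val g)).

Lemma lext_elem (vT : vectType K) p (f : p.+1.-tuple X -> vT) t :
  regular t -> lext f (elem t) = f t.
Proof.
move=> rt.
pose g (u : Rchain p) := \sum_(g : rpath p) u g *: f (val g).
have g_lin : linear g.
  move=> a u v; rewrite /g scaler_sumr -big_split; apply: eq_bigr => i _ /=.
  by rewrite !ffunE scalerDl scalerA.
pose gL := GRing.isLinear.Build K (Rchain p) vT _ g g_lin.
pose G : {linear Rchain p -> vT} := HB.pack g gL.
rewrite /lext (lfunE G) /= /g (bigD1 (Sub t rt : rpath p)) //=.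
rewrite ffunE SubK eqxx scale1r big1 ?addr0 // => i ne_i.
rewrite ffunE; case: eqP => [it|]; last by rewrite scale0r.
by case/eqP: ne_i; apply: val_inj; rewrite SubK.
Qed.

Lemma elem_nonregular p (t : p.+1.-tuple X) : ~~ regular t -> elem t = 0.
Proof.
move=> nrt; apply/ffunP => g; rewrite !ffunE; case: eqP => // gt.
by rewrite -gt (valP g) in nrt.
Qed.

Definition del p (t : p.+2.-tuple X) (q : 'I_p.+2) : p.+1.-tuple X :=
  [tuple tnth t (lift q i) | i < p.+1].

Definition bd p : 'Hom(Rchain p.+1, Rchain p) :=
  lext (fun t => \sum_(q < p.+2) (-1) ^+ q *: elem (del t q)).

Lemma bd_elem p (t : p.+2.-tuple X) : regular t ->
  bd p (elem t) = \sum_(q < p.+2) (-1) ^+ q *: elem (del t q).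
Proof. exact: lext_elem. Qed.

Lemma Rchain_sum p (u : Rchain p) : u = \sum_(g : rpath p) u g *: elem (val g).
Proof.
apply/ffunP => h; rewrite sum_ffunE (bigD1 h) //= !ffunE eqxx.
rewrite big1 ?addr0 => [|i ne_ih]; first by rewrite /GRing.scale /= mulr1.
by rewrite !ffunE (inj_eq val_inj) eq_sym (negPf ne_ih) scaler0.
Qed.

Lemma lext_eq (vT : vectType K) p (f g : 'Hom(Rchain p, vT)) :
  (forall t, regular t -> f (elem t) = g (elem t)) -> f = g.
Proof.
move=> fg; apply/lfunP => u; rewrite (Rchain_sum u) !linear_sum.
by apply: eq_bigr => h _; rewrite !linearZ /= fg // (valP h).
Qed.

Definition Achain p : {vspace Rchain p} :=
  <<[seq elem t | t in [pred t : p.+1.-tuple X | allowed t]]>>%VS.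

Definition path_Omega p : {vspace Rchain p} := Omega bd Achain p.

Definition path_cycles p : {vspace Rchain p} := cycles bd Achain p.

Definition path_homology p : vectType K := homology bd Achain p.

Definition path_class p : 'Hom(Rchain p, path_homology p) :=
  hclass bd Achain p.

End PathHomology.

Section SignedHomology.
Variables (K : fieldType) (D : signed_digraph).

(* the vertex (i, b) is i^eps with eps = (-1) ^+ b *)
Definition cover_arrow (x y : D * bool) : bool :=
  arrow x.1 y.1 && (y.2 == x.2 (+) sgn x.1 y.1).

Fact cover_arrow_irr : irreflexive cover_arrow.
Proof. by case=> i e; rewrite /cover_arrow arrow_irr. Qed.

Definition double_cover : digraph := Digraph cover_arrow_irr.

Definition tau (x : double_cover) : double_cover := (x.1, ~~ x.2).

Definition deck p : 'End(Rchain K double_cover p) :=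
  lext (fun t => elem K (map_tuple tau t)).

Lemma tauK : involutive tau.
Proof. by case=> i e; rewrite /tau negbK. Qed.

Lemma map_tauK p : involutive (map_tuple tau : p.+1.-tuple double_cover -> _).
Proof. by move=> t; apply: val_inj; rewrite /= mapK //; apply: tauK. Qed.

Lemma regular_tau p (t : p.+1.-tuple double_cover) :
  regular (map_tuple tau t) = regular t.
Proof.
rewrite /regular /= sorted_map; apply: eq_sorted => x y /=.
by rewrite (can_eq tauK).
Qed.

Lemma allowed_tau p (t : p.+1.-tuple double_cover) :
  allowed (map_tuple tau t) = allowed t.
Proof.
rewrite /allowed /= sorted_map; apply: eq_sorted => x y /=.
by rewrite /cover_arrow /= addNb (inj_eq negb_inj).
Qed.

Lemma deck_elem p (t : p.+1.-tuple double_cover) :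
  deck p (elem K t) = elem K (map_tuple tau t).
Proof.
have [rt|nrt] := boolP (regular t); first exact: lext_elem.
by rewrite !elem_nonregular ?linear0 // regular_tau.
Qed.

Lemma bd_deck p u :
  bd K double_cover p (deck p.+1 u) = deck p (bd K double_cover p u).
Proof.
suff /lfunP/(_ u) :
    (bd K double_cover p \o deck p.+1 = deck p \o bd K double_cover p)%VF.
  by rewrite !comp_lfunE.
apply: lext_eq => t rt; rewrite !comp_lfunE deck_elem !bd_elem ?regular_tau //.
rewrite linear_sum; apply: eq_bigr => q _; rewrite linearZ /= deck_elem.
suff -> : del (map_tuple tau t) q = map_tuple tau (del t q) by [].
apply: eq_from_tnth => i.
by rewrite !(tnth_mktuple, tnth_map).
Qed.

Lemma deck_Achain p u :
  u \in Achain K double_cover p -> deck p u \in Achain K double_cover p.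
Proof.
move=> Au; suff /subvP :
    (deck p @: Achain K double_cover p <= Achain K double_cover p)%VS.
  by apply; apply: memv_img.
rewrite limg_span; apply/span_subvP => _ /mapP[_ /imageP[t At ->] ->].
rewrite deck_elem; apply/memv_span/image_f.
by rewrite inE allowed_tau.
Qed.

Definition antisum p : {vspace Rchain K double_cover p} :=
  <<[seq (elem K (map_tuple tau t) + elem K t)%R |
      t in [pred t : p.+1.-tuple double_cover | regular t]]>>%VS.

Lemma deck_add_antisum p u : deck p u + u \in antisum p.
Proof.
rewrite (Rchain_sum u) linear_sum -big_split; apply: rpred_sum => g _ /=.
rewrite linearZ -scalerDr /= deck_elem; apply/rpredZ/memv_span/image_f.
exact: valP g.
Qed.

Definition Omega_minus p : {vspace Rchain K double_cover p} :=
  path_Omega K double_cover p :&: minus_part (deck p).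

Definition deck_homology p : 'End(path_homology K double_cover p) :=
  hmap (bd K double_cover) (Achain K double_cover)
       (bd K double_cover) (Achain K double_cover) deck p.

Lemma deck_homology_class p z : z \in path_cycles K double_cover p ->
  deck_homology p (path_class K double_cover p z) =
    path_class K double_cover p (deck p z).
Proof. by apply: hmap_hclass => // q u; [apply: deck_Achain | apply: bd_deck]. Qed.

Definition homology_minus p : {vspace path_homology K double_cover p} :=
  minus_part (deck_homology p).

Definition Rsigma p : vectType K := quotv (antisum p).

Definition Rclass p : 'Hom(Rchain K double_cover p, Rsigma p) := qpi (antisum p).

Definition bd_sigma p : 'Hom(Rsigma p.+1, Rsigma p) :=
  qlift _ (Rclass p \o bd K double_cover p)%VF.

Lemma bd_sigma_class p u :
  bd_sigma p (Rclass p.+1 u) = Rclass p (bd K double_cover p u).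
Proof.
rewrite [LHS]qlift_qpi ?comp_lfunE //; apply/span_subvP => _ /imageP[t _ ->].
rewrite memv_ker comp_lfunE -deck_elem linearD /= bd_deck.
rewrite -(linear0 (Rclass p)); apply/eqP/qpi_eqP; rewrite subr0.
exact: deck_add_antisum.
Qed.

Definition Asigma p : {vspace Rsigma p} :=
  <<[seq Rclass p (elem K t) |
      t in [pred t : p.+1.-tuple double_cover | allowed t]]>>%VS.

Definition Omega_sigma p : {vspace Rsigma p} := Omega bd_sigma Asigma p.

Definition cycles_sigma p : {vspace Rsigma p} := cycles bd_sigma Asigma p.

Definition homology_sigma p : vectType K := homology bd_sigma Asigma p.

Definition class_sigma p : 'Hom(Rsigma p, homology_sigma p) :=
  hclass bd_sigma Asigma p.

Definition Lambda p : 'Hom(Rsigma p, Rchain K double_cover p) :=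
  qlift _ (lext (fun t => elem K t - elem K (map_tuple tau t))).

Lemma Lambda_class p (t : p.+1.-tuple double_cover) : regular t ->
  Lambda p (Rclass p (elem K t)) = elem K t - elem K (map_tuple tau t).
Proof.
move=> rt; rewrite [LHS]qlift_qpi ?lext_elem //.
apply/span_subvP => _ /imageP[s rs ->].
rewrite memv_ker linearD /= !lext_elem ?regular_tau // map_tauK.
by rewrite addrA subrK subrr.
Qed.

End SignedHomology.

(* Main.v *)
(** Let [Rclass] be the projection onto the antisymmetric quotient. On a class,
    [Lambda] reads [u |-> u - tau u], so [Rclass \o Lambda] is multiplication by
    2 and [Lambda \o Rclass] is [1 - tau], which is multiplication by 2 on the
    (-1)-eigenspace of tau. Both are chain maps that preserve the allowed
    spans, so the same two identities hold on Omega and on homology; as 2 is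
    invertible, [Lambda] and half of [Rclass] are inverse to each other. *)
Require Import Defs.
From mathcomp Require Import all_boot all_order all_algebra.
From mathcomp Require Import reals.

Import GRing.Theory Num.Theory.
Local Open Scope ring_scope.

Lemma qpi_surj (K : fieldType) (vT : vectType K) (U : {vspace vT})
  (x : quotv U) : exists u, x = qpi U u.
Proof. by elim/quotW: x => u; exists u; rewrite qpiE. Qed.

(** Reduces identities on homology to cycle representatives, where [hmap_hclass] computes induced
    maps. *)
Lemma hclass_surj (K : fieldType) (C : nat -> vectType K)
    (d : forall p, 'Hom(C p.+1, C p)) (A : forall p, {vspace C p}) p
    (x : homology d A p) :
  exists2 z, z \in cycles d A p & x = hclass d A p z.
Proof.
have [w ->] := qpi_surj _ _ _ x; exists (vsval w); first exact: subvsP.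
by rewrite comp_lfunE [linfun _ (vsval w)]lfunE /= vsvalK.
Qed.

Section Cover.
Variables (K : fieldType) (D : signed_digraph).
Local Notation X := (double_cover D).
Local Notation deck := (deck K D).
Local Notation Rclass := (Rclass K D).
Local Notation Lambda := (Lambda K D).

Lemma deckK p : involutive (deck p).
Proof.
move=> u; suff /lfunP/(_ u) : (deck p \o deck p = \1)%VF.
  by rewrite comp_lfunE id_lfunE.
by apply: lext_eq => t _; rewrite comp_lfunE id_lfunE !deck_elem map_tauK.
Qed.

Lemma Rclass_deck p u : Rclass p (deck p u) = - Rclass p u.
Proof.
apply/eqP; rewrite -addr_eq0 -linearD -(linear0 (Rclass p)).
by apply/eqP/qpi_eqP; rewrite subr0 deck_add_antisum.
Qed.

(** Both sides are linear in [u], so [Lambda_class] on regular elementary paths decides it. Since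
    [Rclass] is onto, this formula determines [Lambda] everywhere. *)
Lemma Lambda_Rclass p u : Lambda p (Rclass p u) = u - deck p u.
Proof.
suff /lfunP/(_ u) : (Lambda p \o Rclass p = \1 - deck p)%VF.
  by rewrite comp_lfunE add_lfunE opp_lfunE id_lfunE.
apply: lext_eq => t rt.
by rewrite comp_lfunE add_lfunE opp_lfunE id_lfunE Lambda_class // deck_elem.
Qed.

Lemma Rclass_Lambda p x : Rclass p (Lambda p x) = x *+ 2.
Proof.
have [u ->] := qpi_surj _ _ _ x.
by rewrite Lambda_Rclass linearB /= Rclass_deck opprK mulr2n.
Qed.

Lemma deck_Lambda p x : deck p (Lambda p x) = - Lambda p x.
Proof.
have [u ->] := qpi_surj _ _ _ x.
by rewrite Lambda_Rclass linearB /= deckK opprB.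
Qed.

Lemma bd_Lambda p x : bd K X p (Lambda p.+1 x) = Lambda p (bd_sigma K D p x).
Proof.
have [u ->] := qpi_surj _ _ _ x.
by rewrite bd_sigma_class !Lambda_Rclass linearB /= bd_deck.
Qed.

Lemma Rclass_Achain p u : u \in Achain K X p -> Rclass p u \in Asigma K D p.
Proof.
move=> Au; have /subvP : (Rclass p @: Achain K X p <= Asigma K D p)%VS.
  rewrite limg_span; apply/span_subvP => _ /mapP[_ /imageP[t At ->] ->].
  exact/memv_span/image_f.
by apply; apply: memv_img.
Qed.

Lemma Lambda_Asigma p x : x \in Asigma K D p -> Lambda p x \in Achain K X p.
Proof.
move=> Ax; have /subvP : (Lambda p @: Asigma K D p <= Achain K X p)%VS.
  rewrite limg_span; apply/span_subvP => _ /mapP[_ /imageP[t At ->] ->].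
  have At' : elem K t \in Achain K X p by apply/memv_span/image_f.
  (* The deck involution preserves allowed paths, so both terms of [u - deck p u] are allowed. *)
  by rewrite Lambda_Rclass rpredB // deck_Achain.
by apply; apply: memv_img.
Qed.

Lemma path_cycles_deck p z :
  z \in path_cycles K X p -> deck p z \in path_cycles K X p.
Proof. by apply: cycles_map => q u; [apply: deck_Achain | apply: bd_deck]. Qed.

Lemma path_cycles_Lambda p z :
  z \in cycles_sigma K D p -> Lambda p z \in path_cycles K X p.
Proof. by apply: cycles_map => q u; [apply: Lambda_Asigma | apply: bd_Lambda]. Qed.

Lemma cycles_sigma_Rclass p z :
  z \in path_cycles K X p -> Rclass p z \in cycles_sigma K D p.
Proof.
by apply: cycles_map => q u; [apply: Rclass_Achain | apply: bd_sigma_class].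
Qed.

Definition Lambda_homology p :
    'Hom(homology_sigma K D p, path_homology K X p) :=
  hmap (bd_sigma K D) (Asigma K D) (bd K X) (Achain K X) Lambda p.

(** Defined on all of the homology of the cover; half of its restriction to the (-1)-eigenspace will
    invert [Lambda_homology]. *)
Definition Rclass_homology p :
    'Hom(path_homology K X p, homology_sigma K D p) :=
  hmap (bd K X) (Achain K X) (bd_sigma K D) (Asigma K D) Rclass p.

Lemma Lambda_homology_class p z : z \in cycles_sigma K D p ->
  Lambda_homology p (class_sigma K D p z) = path_class K X p (Lambda p z).
Proof.
by apply: hmap_hclass => q u; [apply: Lambda_Asigma | apply: bd_Lambda].
Qed.

Lemma Rclass_homology_class p z : z \in path_cycles K X p ->
  Rclass_homology p (path_class K X p z) = class_sigma K D p (Rclass p z).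
Proof.
by apply: hmap_hclass => q u; [apply: Rclass_Achain | apply: bd_sigma_class].
Qed.

Lemma Rclass_Lambda_homology p x :
  Rclass_homology p (Lambda_homology p x) = x *+ 2.
Proof.
have [z Zz ->] := hclass_surj _ _ _ _ _ x.
rewrite Lambda_homology_class // Rclass_homology_class ?path_cycles_Lambda //.
by rewrite Rclass_Lambda linearMn.
Qed.

Lemma Lambda_Rclass_homology p x :
  Lambda_homology p (Rclass_homology p x) = x - deck_homology K D p x.
Proof.
have [z Zz ->] := hclass_surj _ _ _ _ _ x.
rewrite Rclass_homology_class // Lambda_homology_class ?cycles_sigma_Rclass //.
by rewrite Lambda_Rclass linearB /= deck_homology_class.
Qed.

Lemma Lambda_homology_minus p x :
  Lambda_homology p x \in homology_minus K D p.
Proof.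
have [z Zz ->] := hclass_surj _ _ _ _ _ x; apply/minus_partP.
rewrite Lambda_homology_class // deck_homology_class ?path_cycles_Lambda //.
by rewrite deck_Lambda linearN.
Qed.

Hypothesis two_neq0 : 2%:R != 0 :> K.

(** Every division by 2 below passes through this lemma. *)
Lemma halfK (V : lmodType K) (v : V) : 2%:R^-1 *: (v *+ 2) = v.
Proof. by rewrite -scaler_nat scalerA mulVf // scale1r. Qed.

(** Half of [Rclass] is a left inverse on the whole quotient, not only on [Omega_sigma]. *)
Lemma Lambda_inj p : injective (Lambda p).
Proof.
by move=> x y eq_xy; rewrite -[x]halfK -[y]halfK -!Rclass_Lambda eq_xy.
Qed.

Lemma Lambda_Omega p : (Lambda p @: Omega_sigma K D p)%VS = Omega_minus K D p.
Proof.
apply/vspaceP => w; apply/memv_imgP/idP => [[x Ox ->]|].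
  rewrite memv_cap; apply/andP; split; last exact/minus_partP/deck_Lambda.
  by apply: Omega_map Ox => q u; [apply: Lambda_Asigma | apply: bd_Lambda].
rewrite memv_cap => /andP[Ow /minus_partP tw].
(* As [deck p w = - w], applying [Lambda] to [Rclass p w] gives [w - deck p w], which is twice [w];
   hence the factor one half. *)
exists (2%:R^-1 *: Rclass p w); last first.
  by rewrite linearZ /= Lambda_Rclass tw opprK -mulr2n halfK.
apply: memvZ.
by apply: Omega_map Ow => q u; [apply: Rclass_Achain | apply: bd_sigma_class].
Qed.

(** The projection [vsproj] only restricts the codomain: [Lambda_homology_minus] places the image in
    the eigenspace already. *)
Definition Lambda_homology_iso p :
    'Hom(homology_sigma K D p, subvs_of (homology_minus K D p)) :=
  (linfun (vsproj (homology_minus K D p)) \o Lambda_homology p)%VF.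

Lemma val_Lambda_homology_iso p x :
  vsval (Lambda_homology_iso p x) = Lambda_homology p x.
Proof.
by rewrite comp_lfunE [linfun _ _]lfunE /= vsprojK // Lambda_homology_minus.
Qed.

Lemma Lambda_homology_iso_bij p : bijective (Lambda_homology_iso p).
Proof.
exists (fun y => 2%:R^-1 *: Rclass_homology p (vsval y)) => [x|y].
  by rewrite val_Lambda_homology_iso Rclass_Lambda_homology halfK.
apply: val_inj; rewrite [LHS]val_Lambda_homology_iso linearZ /=.
(* Membership of [y] in the eigenspace turns [1 - deck_homology] into multiplication by 2. *)
rewrite Lambda_Rclass_homology; have /minus_partP -> := subvsP y.
by rewrite opprK -mulr2n halfK.
Qed.

End Cover.

Theorem proposition3p10 (R : realType) (D : signed_digraph) :
  (forall p : nat,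
     {in Omega_sigma R D p &, injective (Lambda R D p)} /\
     (Lambda R D p @: Omega_sigma R D p)%VS = Omega_minus R D p) /\
  (forall (p : nat) (z : Rsigma R D p.+1), z \in Omega_sigma R D p.+1 ->
     bd R (double_cover D) p (Lambda R D p.+1 z) = Lambda R D p (bd_sigma R D p z)) /\
  (forall p : nat,
     exists f : 'Hom(homology_sigma R D p, subvs_of (homology_minus R D p)),
       bijective f /\
       forall z : Rsigma R D p, z \in cycles_sigma R D p ->
         Lambda R D p z \in path_cycles R (double_cover D) p /\
         vsval (f (class_sigma R D p z)) =
           path_class R (double_cover D) p (Lambda R D p z)).
Proof.
have two_neq0 : 2%:R != 0 :> R by rewrite pnatr_eq0.
split=> [p|].
  by split; [apply: in2W; exact: Lambda_inj | exact: Lambda_Omega].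
split=> [p z _|p]; first exact: bd_Lambda.
exists (Lambda_homology_iso R D p); split; first exact: Lambda_homology_iso_bij.
move=> z Zz; split; first exact: path_cycles_Lambda.
by rewrite val_Lambda_homology_iso Lambda_homology_class.
Qed.
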